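(* Let $M=(S,\mathcal{I})$ be a matroid, $S_0\subseteq S$ a set containing a basis of $M$, and $w\in\mathbb{Z}^S$. Let $w^*_{\mathrm{All}}\in\mathbb{Z}^S$ be an optimal solution of the IM-All instance $(M,S_0,w,\|\cdot\|_\infty)$ under integrality constraints, and let $\delta=\|w-w^*_{\mathrm{All}}\|_\infty$; suppose that for every connected component $(S_i,\mathcal{I}_i)$ of $M|S_0$ there is $e\in S_i$ with $w^*_{\mathrm{All}}(e)-w(e)=\delta$, and $w^*_{\mathrm{All}}(e)-w(e)=-\delta$ for all $e\in S\setminus S_0$. Then either $w^*_{\mathrm{All}}$ or $w^*_{\mathrm{All}}+\chi_{S_0}-\chi_{S\setminus S_0}$ is an optimal solution of the IM-Only instance $(M,S_0,w,\|\cdot\|_\infty)$.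
   Context: IM-All under integrality constraints: find $w^*\in\mathbb{Z}^S$ such that every basis of $M$ contained in $S_0$ is a maximum $w^*$-weight basis, minimizing $\|w-w^*\|_\infty=\max_s|w(s)-w^*(s)|$. IM-Only: find $w^*\in\mathbb{Z}^S$ such that the maximum $w^*$-weight bases of $M$ are exactly the bases contained in $S_0$, minimizing $\|w-w^*\|_\infty$. $\chi_Z$ is the characteristic vector of $Z$. Connected components of $M|S_0$: restrictions to the classes of the connected components of its circuit hypergraph. *)

(* Defs.v *)
From HB Require Import structures.
From mathcomp Require Import all_boot all_order all_algebra.

Set Implicit Arguments.
Unset Strict Implicit.
Unset Printing Implicit Defensive.

Import Order.TTheory GRing.Theory Num.Theory.

Record matroid (S : finType) := Matroid {
  indep : pred {set S};
  indep0 : indep set0;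
  indepS : forall X Y : {set S}, X \subset Y -> indep Y -> indep X;
  indep_aug : forall X Y : {set S}, indep X -> indep Y -> #|X| < #|Y| ->
    exists2 e, e \in Y :\: X & indep (e |: X)
}.

Section Matroids.
Variables (S : finType) (M : matroid S).

Definition basis (B : {set S}) : bool := maxset (indep M) B.

Definition circuit (C : {set S}) : bool := minset (fun X => ~~ indep M X) C.

End Matroids.

Section Restriction.
Variables (S : finType) (M : matroid S) (A : {set S}).

Definition restrict_indep (X : {set {x : S | x \in A}}) : bool :=
  indep M (val @: X).

Lemma restrict_indep0 : restrict_indep set0.
Proof. by rewrite /restrict_indep imset0 indep0. Qed.

Lemma restrict_indepS (X Y : {set {x : S | x \in A}}) :
  X \subset Y -> restrict_indep Y -> restrict_indep X.
Proof. by move=> sXY; apply: indepS; apply: imsetS. Qed.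

Lemma restrict_indep_aug (X Y : {set {x : S | x \in A}}) :
  restrict_indep X -> restrict_indep Y -> #|X| < #|Y| ->
  exists2 e, e \in Y :\: X & restrict_indep (e |: X).
Proof.
move=> iX iY ltXY.
have [|_ /setDP[/imsetP[e eY ->] eX] ie] := indep_aug iX iY.
  by rewrite !card_imset //; apply: val_inj.
exists e; last by rewrite /restrict_indep imsetU1.
by rewrite inE eY andbT; apply: contra eX; apply: imset_f.
Qed.

Definition restrict : matroid {x : S | x \in A} :=
  Matroid restrict_indep0 restrict_indepS restrict_indep_aug.

End Restriction.

Section Components.
Variables (T : finType) (H : {set {set T}}).

Definition hyper_adj : rel T :=
  [rel x y | [exists h in H, (x \in h) && (y \in h)]].

Lemma hyper_connect_equiv : equivalence_rel (connect hyper_adj).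
Proof.
have csym : connect_sym hyper_adj.
  by apply: sym_connect_sym => x y /=; apply: eq_existsb => h;
     rewrite [(x \in h) && _]andbC.
move=> x y z; split; first exact: connect0.
by move=> xy; apply: (same_connect csym).
Qed.

(* A vertex lying on no hyperedge forms a class of its own. *)
Definition hyper_components : {set {set T}} :=
  equivalence_partition (connect hyper_adj) [set: T].

End Components.

(* Only the ground set of each component is recorded; the component itself is
   the restriction of M to it. *)
Definition matroid_components (S : finType) (M : matroid S) : {set {set S}} :=
  hyper_components [set C | circuit M C].

Local Open Scope ring_scope.

Definition weight (S : finType) (w : {ffun S -> int}) (B : {set S}) : int :=
  \sum_(s in B) w s.

Definition max_weight_basis (S : finType) (M : matroid S)
    (w : {ffun S -> int}) (B : {set S}) : Prop :=
  basis M B /\ forall B', basis M B' -> weight w B' <= weight w B.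

Definition linf_norm (S : finType) (v : {ffun S -> int}) : nat :=
  (\max_(s : S) absz (v s))%N.

Definition char_vec (S : finType) (Z : {set S}) : {ffun S -> int} :=
  [ffun s => (s \in Z)%:R].

Definition IM_All_feasible (S : finType) (M : matroid S) (S0 : {set S})
    (w' : {ffun S -> int}) : Prop :=
  forall B, basis M B -> B \subset S0 -> max_weight_basis M w' B.

Definition IM_Only_feasible (S : finType) (M : matroid S) (S0 : {set S})
    (w' : {ffun S -> int}) : Prop :=
  forall B, max_weight_basis M w' B <-> (basis M B /\ B \subset S0).

Definition closest (S : finType) (feasible : {ffun S -> int} -> Prop)
    (w w' : {ffun S -> int}) : Prop :=
  feasible w' /\
  forall w'', feasible w'' -> (linf_norm (w - w')%R <= linf_norm (w - w'')%R)%N.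

Definition IM_All_optimal (S : finType) (M : matroid S) (S0 : {set S})
    (w w' : {ffun S -> int}) : Prop :=
  closest (IM_All_feasible M S0) w w'.

Definition IM_Only_optimal (S : finType) (M : matroid S) (S0 : {set S})
    (w w' : {ffun S -> int}) : Prop :=
  closest (IM_Only_feasible M S0) w w'.

(* Main.v *)
(** If some IM-Only feasible w'' lies within delta of w, then w'' <= wAll at one
    element of each component of M|S0, hence on all of S0 because feasible
    vectors are constant on components, while w'' >= wAll off S0. So passing
    from w'' to wAll only favours bases inside S0: comparing a basis B' with a
    basis of S0 containing B' :&: S0 shows that wAll is itself IM-Only feasible.
    Otherwise every IM-Only feasible vector has distance at least delta + 1,
    which the shifted vector attains. *)

Require Import Defs.
From HB Require Import structures.
From mathcomp Require Import all_boot all_order all_algebra.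
From mathcomp Require Import zify.

Set Implicit Arguments.
Unset Strict Implicit.
Unset Printing Implicit Defensive.

Import Order.TTheory GRing.Theory Num.Theory.
Local Open Scope ring_scope.

Section MatroidTheory.
Variables (S : finType) (M : matroid S).
Implicit Types (A B C I X : {set S}) (v w : {ffun S -> int}).

Lemma indep_card_basis B X : basis M B -> indep M X -> (#|X| <= #|B|)%N.
Proof.
move=> /maxsetP[iB maxB] iX; rewrite leqNgt; apply/negP => ltBX.
have [e /setDP[_ eB] ie] := indep_aug iB iX ltBX.
by case/negP: eB; rewrite -(maxB _ ie (subsetUr _ _)) setU11.
Qed.

Lemma basis_card B B' : basis M B -> basis M B' -> #|B| = #|B'|.
Proof.
move=> bB bB'; apply/eqP; rewrite eqn_leq !indep_card_basis //.
  by case/maxsetP: bB'.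
by case/maxsetP: bB.
Qed.

Lemma card_basis B X : basis M B -> indep M X -> (#|B| <= #|X|)%N -> basis M X.
Proof.
move=> bB iX leBX; apply/maxsetP; split=> // Y iY sXY.
apply/esym/eqP; rewrite eqEcard sXY /=.
exact: (leq_trans (indep_card_basis bB iY)).
Qed.

(** Take [B'] maximal among the independent sets inside [A] that contain [I]. Augmenting it from [B]
    would stay inside [A], so [B'] is at least as large as [B] and is a basis of [M]. *)
Lemma basis_extend A B I : basis M B -> B \subset A -> indep M I ->
  I \subset A -> exists B', [/\ basis M B', I \subset B' & B' \subset A].
Proof.
move=> bB sBA iI sIA.
have [|B' /maxsetP[/andP[iB' sB'A] maxB'] sIB'] :=
  @maxset_exists _ (fun X => indep M X && (X \subset A)) I; first exact/andP.
exists B'; split=> //; apply: (card_basis bB iB').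
have /maxsetP[iB _] := bB.
rewrite leqNgt; apply/negP => lt.
have [e /setDP[eB eB'] ie] := indep_aug iB' iB lt.
case/negP: eB'; rewrite -(maxB' (e |: B')) ?setU11 ?subsetUr //.
by rewrite ie subUset sub1set (subsetP sBA) // sB'A.
Qed.

Lemma circuit_indepD1 C x : circuit M C -> x \in C -> indep M (C :\ x).
Proof.
move=> /minsetP[_ minC] xC; apply/negPn/negP => dep.
by have := minC _ dep (subD1set _ _) => /setP/(_ x); rewrite !inE eqxx xC.
Qed.

(** Extending [C :\ x] inside [A] gives [B], which avoids [x] because [C] is dependent. Extending
    [C :\ y] inside [x |: B] gives a basis avoiding [y], and equicardinality leaves only
    [x |: B :\ y]. *)
Lemma circuit_exchange A C x y :
    (exists2 B, basis M B & B \subset A) ->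
    circuit M C -> C \subset A -> x \in C -> y \in C -> x != y ->
  exists B, [/\ basis M B, B \subset A, x \notin B, y \in B &
                basis M (x |: B :\ y)].
Proof.
move=> [B0 bB0 sB0A] cC sCA xC yC xy.
have /minsetP[depC _] := cC.
have dep z B : basis M B -> C :\ z \subset B -> z \notin B.
  move=> /maxsetP[iB _] sCB; apply: contra depC => zB.
  apply: indepS iB; apply/subsetP=> t tC.
  by have [->//|tz] := eqVneq t z; rewrite (subsetP sCB) // !inE tz.
have [B [bB sCB sBA]] := basis_extend bB0 sB0A (circuit_indepD1 cC xC)
  (subset_trans (subD1set C x) sCA).
have xB := dep _ _ bB sCB.
have yB : y \in B by rewrite (subsetP sCB) // !inE eq_sym xy.
have sCyB : C :\ y \subset x |: B.
  apply/subsetP=> t; rewrite !inE => /andP[_ tC].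
  by have [//|tx] := eqVneq t x; rewrite (subsetP sCB) // !inE tx.
have [B' [bB' sCB' sB'B]] :=
  basis_extend bB (subsetUr [set x] B) (circuit_indepD1 cC yC) sCyB.
exists B; split=> //; have yB' := dep _ _ bB' sCB'.
suff <- : B' = x |: B :\ y by [].
apply/eqP; rewrite eqEcard; apply/andP; split.
  apply/subsetP=> t tB'; have := subsetP sB'B t tB'; rewrite !inE.
  by case: (eqVneq t y) tB' => [->|]//; rewrite (negPf yB').
by rewrite cardsU1 !inE (negPf xB) andbF (basis_card bB' bB) (cardsD1 y B) yB.
Qed.

Lemma circuit_restrict A (C : {set {x : S | x \in A}}) :
  circuit (restrict M A) C -> circuit M (val @: C).
Proof.
move=> /minsetP[depC minC]; apply/minsetP; split=> // X depX sXC.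
have defX : val @: (val @^-1: X : {set {x : S | x \in A}}) = X.
  apply/setP=> t; apply/imsetP/idP => [[u uX ->]|tX]; first by rewrite inE in uX.
  have /imsetP[u _ tu] := subsetP sXC t tX.
  by exists u; rewrite // inE -tu.
rewrite -(minC (val @^-1: X)) //=; first by rewrite /restrict_indep defX.
apply/subsetP=> u; rewrite inE => uX.
by have /imsetP[u' u'C /val_inj->] := subsetP sXC _ uX.
Qed.

(** The two bases of [circuit_exchange] both lie in [A], so both have maximum weight, and their
    weights differ by [w x - w y]. *)
Lemma IM_All_feasible_circuit A w C x y :
    (exists2 B, basis M B & B \subset A) -> IM_All_feasible M A w ->
    circuit M C -> C \subset A -> x \in C -> y \in C ->
  w x = w y.
Proof.
move=> hA feas cC sCA xC yC; have [->//|xy] := eqVneq x y.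
have [B [bB sBA xB yB bB']] := circuit_exchange hA cC sCA xC yC xy.
have sB'A : x |: B :\ y \subset A.
  by rewrite subUset sub1set (subsetP sCA) // (subset_trans (subD1set _ _)).
have := (feas _ bB sBA).2 _ bB'; have := (feas _ bB' sB'A).2 _ bB.
rewrite /weight big_setU1 ?(big_setD1 y yB) ?inE ?(negPf xB) ?andbF //=.
lia.
Qed.

Lemma IM_All_feasible_component A w (K : {set {x : S | x \in A}}) e x :
    (exists2 B, basis M B & B \subset A) -> IM_All_feasible M A w ->
    K \in matroid_components (restrict M A) -> e \in K -> x \in K ->
  w (val e) = w (val x).
Proof.
move=> hA feas Kcomp eK xK.
set H := [set C | circuit (restrict M A) C].
have eqv : {in [set: _] & &, equivalence_rel (connect (hyper_adj H))}.
  by move=> ? ? ? _ _ _; apply: hyper_connect_equiv.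
have /connectP[p] : connect (hyper_adj H) e x.
  have /and3P[_ tK _] := equivalence_partitionP eqv.
  have := pblock_equivalence_partition eqv (in_setT e) (in_setT x).
  by rewrite (def_pblock tK Kcomp eK) xK => <-.
(* Walk along a path of the circuit hypergraph: consecutive vertices share a circuit of the
   restriction, whose image is a circuit of [M] inside [A]. *)
elim: p e {eK} => [|z p IH] e /=; first by move=> _ ->.
move=> /andP[/existsP[C /and3P[CH eC zC]] zp] lastx.
rewrite -(IH z zp lastx); rewrite inE in CH.
apply: (IM_All_feasible_circuit hA feas (circuit_restrict CH)); rewrite ?imset_f //.
by apply/subsetP=> _ /imsetP[u _ ->]; apply: valP.
Qed.

Lemma IM_Only_feasibleW A w : IM_Only_feasible M A w -> IM_All_feasible M A w.
Proof. by move=> feas B bB sBA; apply/feas. Qed.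

Lemma weight_setID A w B :
  weight w B = weight w (B :&: A) + weight w (B :\: A).
Proof. by rewrite /weight (big_setID A). Qed.

Lemma ler_weight v w X : {in X, forall s, v s <= w s} ->
  weight v X <= weight w X.
Proof. by move=> le_vw; apply: ler_sum. Qed.

Lemma IM_Only_feasible_gap A w :
    (exists2 B, basis M B & B \subset A) -> IM_All_feasible M A w ->
    (forall B', basis M B' -> ~~ (B' \subset A) ->
       exists2 B, basis M B & weight w B' < weight w B) ->
  IM_Only_feasible M A w.
Proof.
move=> [B0 bB0 sB0A] feas gap B; split=> [[bB maxB]|[bB sBA]]; last exact: feas.
split=> //; apply/negPn/negP => nsBA.
have [B' bB' lt] := gap _ bB nsBA.
by have := maxB _ bB'; rewrite leNgt lt.
Qed.

Lemma IM_Only_feasible_shift A v w :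
    (exists2 B, basis M B & B \subset A) ->
    IM_All_feasible M A w -> IM_Only_feasible M A v ->
    {in A, forall s, v s <= w s} -> {in ~: A, forall s, w s <= v s} ->
  IM_Only_feasible M A w.
Proof.
move=> hA wfeas vfeas le_vw le_wv.
apply: IM_Only_feasible_gap => // B' bB' nsB'A.
have [B0 bB0 sB0A] := hA; have /maxsetP[iB' _] := bB'.
have [B [bB sIB sBA]] :=
  basis_extend bB0 sB0A (indepS (subsetIl B' A) iB') (subsetIr B' A).
exists B => //.
(* Otherwise [B'] would also have maximum [v]-weight and hence lie in [A]. *)
have lt_v : weight v B' < weight v B.
  rewrite ltNge; apply: contra nsB'A => le_v.
  have [_ maxB] := (vfeas B).2 (conj bB sBA).
  suff /vfeas[] : max_weight_basis M v B' by [].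
  by split=> // B1 bB1; apply: (le_trans _ le_v); apply: maxB.
(* The common part of the two bases cancels in the comparison: from [v] to [w], what remains of [B']
   lies off [A] and cannot gain, and what remains of [B] lies in [A] and cannot lose. *)
have BB' : B :&: B' = B' :&: A.
  apply/eqP; rewrite eqEsubset !subsetI sIB subsetIl subsetIr.
  by rewrite (subset_trans (subsetIl B B') sBA).
have B'DA : {in B' :\: A, forall s, w s <= v s}.
  by move=> s /setDP[_ sA]; apply: le_wv; rewrite inE.
have BDB' : {in B :\: B', forall s, v s <= w s}.
  by move=> s /setDP[sB _]; apply: le_vw; apply: (subsetP sBA).
have := ler_weight B'DA; have := ler_weight BDB'.
move: lt_v; rewrite !(weight_setID B' _ B) !(weight_setID A _ B') BB'.
lia.
Qed.

Lemma weight_char_shift A w B :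
  weight (w + char_vec A - char_vec ([set: S] :\: A)) B =
  weight w B + #|B :&: A|%:Z - #|B :\: A|%:Z.
Proof.
have card_char Z : weight (char_vec Z) B = #|B :&: Z|%:Z.
  rewrite (weight_setID Z) /weight [X in _ + X]big1 ?addr0.
    rewrite -natz -sumr_const; apply: eq_bigr => s /setIP[_ sZ].
    by rewrite ffunE sZ.
  by move=> s /setDP[_ sZ]; rewrite ffunE (negPf sZ).
have -> : B :\: A = B :&: ([set: S] :\: A) by rewrite setTD setDE.
rewrite -!card_char /weight -big_split -sumrB /=.
by apply: eq_bigr => s _; rewrite !ffunE.
Qed.

(** All bases have the same size [r]. The shift adds [r] to the weight of a basis inside [A], but
    only [r - 2k] to one with [k] elements outside, so ties are broken in favour of [A]. *)
Lemma IM_Only_feasible_char_shift A w :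
    (exists2 B, basis M B & B \subset A) -> IM_All_feasible M A w ->
  IM_Only_feasible M A (w + char_vec A - char_vec ([set: S] :\: A)).
Proof.
move=> hA feas.
have wA B : B \subset A -> weight (w + char_vec A - char_vec ([set: S] :\: A)) B
    = weight w B + #|B|%:Z.
  move=> sBA; rewrite weight_char_shift (setIidPl sBA).
  by move: (sBA); rewrite -setD_eq0 => /eqP->; rewrite cards0 subr0.
have leB B B' : basis M B -> B \subset A -> basis M B' ->
    weight w B' + #|B'|%:Z <= weight w B + #|B|%:Z.
  by move=> bB sBA bB'; rewrite (basis_card bB' bB) lerD2r (feas B bB sBA).2.
apply: IM_Only_feasible_gap => // [B bB sBA|B' bB' nsB'A].
  split=> // B' bB'; rewrite (wA B) //; apply: (le_trans _ (leB B B' bB sBA bB')).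
  rewrite weight_char_shift -(cardsID A B'); lia.
have [B bB sBA] := hA; exists B => //.
rewrite (wA B) //; apply: (lt_le_trans _ (leB B B' bB sBA bB')).
have : (0 < #|B' :\: A|)%N by rewrite card_gt0 setD_eq0.
rewrite weight_char_shift -(cardsID A B'); lia.
Qed.

Lemma linf_distP v w n :
  reflect (forall s, (absz (v s - w s)%R <= n)%N) (linf_norm (v - w)%R <= n)%N.
Proof.
apply: (iffP (bigmax_leqP _ _ _)) => le s; last move=> _; move: (le s).
  by rewrite !ffunE; apply.
by rewrite !ffunE.
Qed.

End MatroidTheory.

Theorem theorem5p4 (S : finType) (M : matroid S) (S0 : {set S})
    (hS0 : exists2 B : {set S}, basis M B & B \subset S0)
    (w wAll : {ffun S -> int})
    (hAll : IM_All_optimal M S0 w wAll)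
    (delta : nat) (hdelta : delta = linf_norm (w - wAll))
    (hcomp : forall Si : {set {x : S | x \in S0}},
      Si \in matroid_components (restrict M S0) ->
      exists2 e, e \in Si & wAll (val e) - w (val e) = delta%:Z)
    (hout : forall e : S, e \in [set: S] :\: S0 -> wAll e - w e = - delta%:Z) :
  IM_Only_optimal M S0 w wAll \/
  IM_Only_optimal M S0 w (wAll + char_vec S0 - char_vec ([set: S] :\: S0)).
Proof.
have [feasAll minAll] := hAll.
have shift_feas := IM_Only_feasible_char_shift hS0 feasAll.
have shift_norm : (linf_norm
    (w - (wAll + char_vec S0 - char_vec ([set: S] :\: S0)))%R <= delta.+1)%N.
  apply/linf_distP=> s.
  have /linf_distP/(_ s) : (linf_norm (w - wAll)%R <= delta)%N by rewrite hdelta.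
  (* The shift moves every entry by exactly one. *)
  by rewrite !ffunE !inE andbT; case: (s \in S0) => /=; lia.
have close v : IM_Only_feasible M S0 v -> (linf_norm (w - v)%R <= delta)%N ->
    IM_Only_feasible M S0 wAll.
  move=> vfeas /linf_distP vdelta.
  apply: (IM_Only_feasible_shift hS0 feasAll vfeas) => s sS0; last first.
    (* Off [S0], [wAll] takes the least value within [delta] of [w], so [v] cannot be below it. *)
    have -> : wAll s = w s - delta%:Z.
      by rewrite -(hout s) ?setTD // addrC subrK.
    by have := vdelta s; lia.
  pose x := exist (fun x => x \in S0) s sS0.
  set P := matroid_components (restrict M S0).
  have /and3P[/eqP covP _ _] : partition P [set: _].
    apply: equivalence_partitionP => ? ? ? _ _ _.
    exact: hyper_connect_equiv.
  have xP : x \in cover P by rewrite covP inE.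
  have [e eK he] := hcomp _ (pblock_mem xP).
  have xK : x \in pblock P x by rewrite mem_pblock.
  (* At [e], [wAll] takes the largest value within [delta] of [w]. Both vectors are constant on the
     component, which carries the inequality over to [s]. *)
  have le_e : v (val e) <= wAll (val e).
    have -> : wAll (val e) = w (val e) + delta%:Z by rewrite -he addrC subrK.
    by have := vdelta (val e); lia.
  have vfeas' := IM_Only_feasibleW vfeas.
  move: le_e.
  rewrite (IM_All_feasible_component hS0 vfeas' (pblock_mem xP) eK xK).
  by rewrite (IM_All_feasible_component hS0 feasAll (pblock_mem xP) eK xK).
(* IM-Only feasibility is not decided constructively, so split on an
   equivalent boolean test over the finitely many bases. *)
pose onlyb := [forall B : {set S}, (basis M B && ~~ (B \subset S0)) ==>
  [exists B' : {set S}, basis M B' && (weight wAll B < weight wAll B')]].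
have [only|nonly] := boolP onlyb.
  (* IM-Only competitors are also IM-All feasible, so the minimality of [wAll] applies to them. *)
  left; split=> [|v /IM_Only_feasibleW]; last exact: minAll.
  apply: IM_Only_feasible_gap => // B' bB' nsB'.
  have := forallP only B'; rewrite bB' nsB' => /existsP[B /andP[bB lt]].
  by exists B.
right; split=> // v vfeas; apply: (leq_trans shift_norm).
(* A competitor within [delta] would make [wAll] IM-Only feasible. Then any basis in [S0] strictly
   outweighs every basis not inside [S0], contradicting [nonly]. *)
rewrite ltnNge; apply: contra nonly => /(close v vfeas) feas.
apply/forallP=> B; apply/implyP => /andP[bB nsB]; apply/existsP.
have [B0 bB0 sB0] := hS0; exists B0; rewrite bB0 /= ltNge.
apply: contra nsB => le.
suff /feas[] : max_weight_basis M wAll B by [].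
by split=> // B1 bB1; apply: (le_trans _ le); apply: (feasAll B0 bB0 sB0).2.
Qed.
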